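(* Let $T>0$, $\alpha=\frac32$, $t_0\in(0,T)$, $\rho_0>0$ and $x_0\in\mathbb R^3$. Let $B$ be a classical solution on $[t_0,T)$ of $$B_t+\nabla\times((\nabla\times B)\times B)=0,\qquad \nabla\cdot B=0\quad\text{in }\mathbb R^3,$$ which is locally self-similar, i.e. for some profile vector field $H:\mathbb R^3\to\mathbb R^3$, $$B(x,t)=\frac{1}{(T-t)^{\frac{\alpha}{\alpha+2}}}\,H\!\left(\frac{x-x_0}{(T-t)^{\frac{1}{\alpha+2}}}\right)\qquad\text{for all }(x,t)\in B_{\rho_0}(x_0)\times(t_0,T).$$ Suppose that $H\in L^2(\mathbb R^3)\cap C^2_{loc}(\mathbb R^3)$ and that there exist $\delta>0$ and constants $c>0$, $C>0$ such that, for all sufficiently large $|y|$, $$|H(y)|\ge c\,|y|^{-\frac32-\delta}\qquad\text{and}\qquad |\nabla\times H(y)|\le C\,|y|^{1-\delta}.$$ Then $H\equiv 0$ (that is, the hypotheses cannot be satisfied by a nontrivial profile).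
   Context: The system is the electron MHD system with zero resistivity. $B_{\rho_0}(x_0)$ denotes the ball of radius $\rho_0$ centered at $x_0$ in $\mathbb R^3$. The profile $H$ satisfies $$\frac{\alpha}{\alpha+2}H+\frac{1}{\alpha+2}\,y\cdot\nabla H+\nabla\times((\nabla\times H)\times H)=0,\qquad \nabla\cdot H=0,$$ with $y=\frac{x-x_0}{(T-t)^{1/(\alpha+2)}}$ and $\alpha=\frac32$. *)

(* Defs.v *)
From HB Require Import structures.
From mathcomp Require Import all_boot all_order all_algebra.
From mathcomp Require Import all_classical all_reals all_analysis.

Set Implicit Arguments.
Unset Strict Implicit.
Unset Printing Implicit Defensive.

Import Order.TTheory GRing.Theory Num.Theory.
Import numFieldNormedType.Exports.

Local Open Scope classical_set_scope.
Local Open Scope ring_scope.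

(* The norm `|x| of 'rV[R]_n is the sup norm, hence this definition. *)
Definition enorm (R : realType) (n : nat) (x : 'rV[R]_n) : R :=
  Num.sqrt (\sum_(i < n) x 0 i ^+ 2).

Definition eball (R : realType) (n : nat) (x0 : 'rV[R]_n) (r : R)
  : set 'rV[R]_n := [set x | enorm (x - x0) < r].

Definition vec3 (R : realType) (a b c : R) : 'rV[R]_3 :=
  \row_(i < 3) nth 0 [:: a; b; c] i.

Definition cross (R : realType) (u v : 'rV[R]_3) : 'rV[R]_3 :=
  vec3 (u 0 1 * v 0 2%:R - u 0 2%:R * v 0 1)
       (u 0 2%:R * v 0 0 - u 0 0 * v 0 2%:R)
       (u 0 0 * v 0 1 - u 0 1 * v 0 0).

Definition partial (R : realType) (n m : nat) (i : 'I_n)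
    (F : 'rV[R]_n -> 'rV[R]_m) (x : 'rV[R]_n) : 'rV[R]_m :=
  'D_(delta_mx 0 i) F x.

Definition curl (R : realType) (F : 'rV[R]_3 -> 'rV[R]_3) (x : 'rV[R]_3)
    : 'rV[R]_3 :=
  vec3 (partial 1 F x 0 2%:R - partial 2%:R F x 0 1)
       (partial 2%:R F x 0 0 - partial 0 F x 0 2%:R)
       (partial 0 F x 0 1 - partial 1 F x 0 0).

Definition divergence (R : realType) (n : nat) (F : 'rV[R]_n -> 'rV[R]_n)
    (x : 'rV[R]_n) : R :=
  \sum_(i < n) partial i F x 0 i.

Definition hall (R : realType) (F : 'rV[R]_3 -> 'rV[R]_3)
    : 'rV[R]_3 -> 'rV[R]_3 :=
  curl (fun x => cross (curl F x) (F x)).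

(* Continuity of the partial derivatives implies that of F. *)
Definition C1 (R : realType) (n m : nat) (F : 'rV[R]_n -> 'rV[R]_m) : Prop :=
  forall i : 'I_n,
    (forall x, derivable F x (delta_mx 0 i)) /\ continuous (partial i F).

Definition C2 (R : realType) (n m : nat) (F : 'rV[R]_n -> 'rV[R]_m) : Prop :=
  C1 F /\ forall i : 'I_n, C1 (partial i F).

Definition lebesgue3 (R : realType) :=
  ((@lebesgue_measure R \x @lebesgue_measure R) \x @lebesgue_measure R)%E.

Definition L2_field (R : realType) (F : 'rV[R]_3 -> 'rV[R]_3) : Prop :=
  forall i : 'I_3,
    (fun p : R * R * R => F (vec3 p.1.1 p.1.2 p.2) 0 i)
      \in Lfun (@lebesgue3 R) 2%:E.

(* Restricting to [t0, T[ makes the time derivative one-sided at t0. *)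
Definition is_time_derivative (R : realType) (t0 T : R)
    (B Bt : 'rV[R]_3 -> R -> 'rV[R]_3) : Prop :=
  forall (x : 'rV[R]_3) (t : R), t0 <= t < T ->
    (fun s => (s - t)^-1 *: (B x s - B x t)) @ within `[t0, T[ t^' --> Bt x t.

Definition continuous_on_slab (R : realType) (t0 T : R)
    (F : 'rV[R]_3 -> R -> 'rV[R]_3) : Prop :=
  {within [set z : 'rV[R]_3 * R | t0 <= z.2 < T],
     continuous (fun z => F z.1 z.2)}.

(* Of class C^2 in x and C^1 in t on R^3 x [t0, T[, all these derivatives being
   jointly continuous, with the equations holding pointwise. *)
Definition classical_solution (R : realType) (t0 T : R)
    (B : 'rV[R]_3 -> R -> 'rV[R]_3) : Prop :=
  exists Bt : 'rV[R]_3 -> R -> 'rV[R]_3,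
    [/\ is_time_derivative t0 T B Bt,
        forall t, t0 <= t < T -> C2 (B ^~ t),
        [/\ continuous_on_slab t0 T B,
            continuous_on_slab t0 T Bt,
            forall i, continuous_on_slab t0 T
              (fun x t => partial i (B ^~ t) x)
          & forall i j, continuous_on_slab t0 T
              (fun x t => partial j (partial i (B ^~ t)) x)],
        forall x t, t0 <= t < T -> Bt x t + hall (B ^~ t) x = 0
      & forall x t, t0 <= t < T -> divergence (B ^~ t) x = 0].

Definition locally_self_similar (R : realType) (alpha t0 T rho0 : R)
    (x0 : 'rV[R]_3) (B : 'rV[R]_3 -> R -> 'rV[R]_3)
    (H : 'rV[R]_3 -> 'rV[R]_3) : Prop :=
  forall (x : 'rV[R]_3) (t : R), x \in eball x0 rho0 -> t0 < t < T ->
    B x t = ((T - t) `^ (alpha / (alpha + 2)))^-1 *: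
              H (((T - t) `^ (1 / (alpha + 2)))^-1 *: (x - x0)).

(* Main.v *)
(* With J = curl H and alpha = 3/2, the scalar product of the profile equation
   with H reads div (|H|^2 y / 7 + (J x H) x H) = 0: the exponent 3/2 is the one
   for which the first two terms of the equation form an exact divergence.  On
   a face of the cube [-r, r]^3 the outward normal component of this field is at
   least (r / 7 - |J|) |H|^2, and |J| <= C |y|^(1 - delta) = o(r) there, while
   the lower bound on H keeps |H|^2 away from 0.  So for r large a
   divergence-free field flows strictly outwards through every face of a cube,
   which is absurd: the hypotheses are contradictory. *)
Require Import Defs.
From HB Require Import structures.
From mathcomp Require Import all_boot all_order all_algebra.
From mathcomp Require Import all_classical all_reals all_analysis.
From mathcomp Require Import ring lra.
Set Implicit Arguments.
Unset Strict Implicit.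
Unset Printing Implicit Defensive.

Import Order.TTheory GRing.Theory Num.Theory.
Import numFieldNormedType.Exports.

Local Open Scope classical_set_scope.
Local Open Scope ring_scope.

(** * Mean value theorem along lines and uniform continuity near compact sets *)

Lemma is_derive_line (R : realType) (V W : normedModType R) (f : V -> W)
    (x v : V) (s : R) (l : W) :
  is_derive (x + s *: v) v f l -> is_derive s (1 : R) (fun u => f (x + u *: v)) l.
Proof.
case=> df fl.
have E : (fun h : R => h^-1 *: (f (x + (h *: 1 + s) *: v) - f (x + s *: v))) =
   (fun h : R => h^-1 *: ((f \o shift (x + s *: v)) (h *: v) - f (x + s *: v))).
  by apply/funext => h /=; rewrite /shift /= [h *: 1]mulr1 scalerDl addrCA.
by split; rewrite /derivable /derive /= E.
Qed.

(** Restriction of [f] to the line through [x] directed by [v]. Both signs of [h] are covered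
    because the coordinates of a displacement have no fixed sign. *)
Lemma MVT_line (R : realType) (V : normedModType R) (f : V -> R) (x v : V) (h : R) :
  (forall y, derivable f y v) ->
  exists2 u, `|u| <= `|h| & f (x + h *: v) - f x = 'D_v f (x + u *: v) * h.
Proof.
move=> df.
have dl (s : R) : is_derive s (1 : R) (fun u => f (x + u *: v)) ('D_v f (x + s *: v)).
  by apply: is_derive_line; apply: derivableP.
have cl (a b : R) : {within `[a, b], continuous (fun u => f (x + u *: v))}.
  by apply: derivable_within_continuous => y _; case: (dl y).
have [h0|h0] := leP 0 h.
  have [u /andP[u0 uh]] := MVT_segment h0 (fun s _ => dl s) (cl _ _).
  rewrite !bnd_simp in u0 uh.
  rewrite scale0r addr0 subr0 => E; exists u => //.
  by rewrite !ger0_norm.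
have [u /andP[u0 uh]] := MVT_segment (ltW h0) (fun s _ => dl s) (cl _ _).
rewrite !bnd_simp in u0 uh.
rewrite scale0r addr0 sub0r mulrN => /(congr1 -%R); rewrite opprK opprB => E.
exists u => //.
by rewrite !ler0_norm ?lerN2 // ltW.
Qed.

(** Heine's theorem from the near-covering form of compactness, the radius [d] tending to 0 from the
    right. Only [x] is confined to [K]: the intermediate points given by [MVT_line] may leave it. *)
Lemma near_uniform_on_compact (R : realType) (V : normedModType R) (g : V -> R)
    (K : set V) (e : R) : 0 < e -> continuous g -> compact K ->
  exists2 d, 0 < d & forall x y, K x -> `|y - x| < d -> `|g y - g x| < e.
Proof.
move=> e0 cg /compact_near_coveringP cK.
have := cK R (0 : R)^'+ (fun d x => forall y, `|y - x| < d -> `|g y - g x| < e) _.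
case.
  move=> x Kx.
  have e20 : 0 < e / 2 by rewrite divr_gt0.
  have /cvgrPdist_lt /(_ _ e20) /nbhs_normP[d /= d0 dP] := cg x.
  exists (ball x (d / 2), [set t : R | t < d / 2]) => /=.
    split; first by apply: nbhsx_ballx; rewrite divr_gt0.
    by apply: nbhs_right_lt; rewrite divr_gt0.
  move=> [z t] /= [+ td] y yz; rewrite -ball_normE /= => zx.
  have zd : ball_ Num.norm x d z.
    by rewrite /= (lt_trans zx)// ltr_pdivrMr// mulr_natr mulr2n ltrDl.
  have yd : ball_ Num.norm x d y.
    rewrite /= -(subrKA z) (le_lt_trans (ler_normD _ _))//.
    rewrite [ltRHS]splitr ltrD// distrC (lt_trans yz)//.
  have := dP _ zd; have := dP _ yd => /= h1 h2.
  rewrite -(subrKA (g x)) (le_lt_trans (ler_normD _ _))//.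
  by rewrite [ltRHS]splitr ltrD// distrC.
move=> d /= d0 dP; exists (d / 2); first by rewrite divr_gt0.
move=> x y Kx yx; apply: (dP (d / 2)) => //=.
- by rewrite sub0r normrN gtr0_norm ?divr_gt0// ltr_pdivrMr// mulr_natr mulr2n ltrDl.
- by rewrite divr_gt0.
Qed.

(** * Coordinates of row vectors and a discrete divergence theorem on a cube *)

Lemma telescope_ord (V : zmodType) (f : nat -> V) (n : nat) :
  \sum_(k < n) (f k.+1 - f k) = f n - f 0%N.
Proof. by rewrite -(big_mkord xpredT (fun k => f k.+1 - f k)) telescope_sumr. Qed.

Lemma vec3_0 (R : realType) (a b c : R) : vec3 a b c 0 0 = a.
Proof. by rewrite mxE. Qed.

Lemma vec3_1 (R : realType) (a b c : R) : vec3 a b c 0 1 = b.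
Proof. by rewrite mxE. Qed.

Lemma vec3_2 (R : realType) (a b c : R) : vec3 a b c 0 2%:R = c.
Proof. by rewrite mxE. Qed.

Definition vec3E := (vec3_0, vec3_1, vec3_2).

Lemma forall_ord3 (P : 'I_3 -> Prop) : P 0 -> P 1 -> P 2%:R -> forall i, P i.
Proof.
move=> P0 P1 P2 [[|[|[|//]]] i3].
- by rewrite (_ : Ordinal i3 = 0)//; apply: val_inj.
- by rewrite (_ : Ordinal i3 = 1)//; apply: val_inj.
- by rewrite (_ : Ordinal i3 = 2%:R)//; apply: val_inj.
Qed.

Lemma sum_ord3 (V : nmodType) (f : 'I_3 -> V) :
  \sum_i f i = f 0 + f 1 + f 2%:R.
Proof.
rewrite !big_ord_recl big_ord0 addr0 addrA.
by congr (_ + f _ + f _); apply: val_inj.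
Qed.

Lemma row3P (T : Type) (u v : 'rV[T]_3) :
  u 0 0 = v 0 0 -> u 0 1 = v 0 1 -> u 0 2%:R = v 0 2%:R -> u = v.
Proof. by move=> u0 u1 u2; apply/rowP; exact: forall_ord3. Qed.

Lemma norm_delta_mx (R : realType) (n : nat) (i : 'I_n) :
  `|delta_mx 0 i : 'rV[R]_n| <= 1.
Proof.
rewrite /Num.Def.normr/= mx_normrE; apply: bigmax_le => // -[a b] _ /=.
by rewrite mxE; case: (_ && _); rewrite ?normr1 ?normr0 ?ler01.
Qed.

Lemma compact_cube (R : realType) (n : nat) (r : R) :
  compact [set x : 'rV[R]_n | forall j, `|x 0 j| <= r].
Proof.
have := @rV_compact R n (fun=> `[- r, r]%classic) (fun=> @segment_compact _ _ _).
congr compact; apply/funext => x /=; apply/propext.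
by split=> h j; have := h j; rewrite ler_norml in_itv.
Qed.

(* A discrete divergence theorem, which avoids integrals: by the mean value
   theorem the increments of the [F i] over a cell of side [h] add up to at most
   [h * (div F + 3 * e)], and over a grid they telescope to face values. *)
Lemma divergence_free_no_outflow (R : realType) (F : 'I_3 -> 'rV[R]_3 -> R)
    (r m : R) :
  0 < r -> 0 < m ->
  (forall i x, derivable (F i) x (delta_mx 0 i)) ->
  (forall i, continuous (fun x => derive (F i) x (delta_mx 0 i))) ->
  (forall x, \sum_i derive (F i) x (delta_mx 0 i) = 0) ->
  (forall i (x : 'rV[R]_3), (forall j, `|x 0 j| <= r) -> x 0 i = r -> m <= F i x) ->
  (forall i (x : 'rV[R]_3), (forall j, `|x 0 j| <= r) -> x 0 i = - r -> F i x <= - m) ->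
  False.
Proof.
move=> r0 m0 dF cF divF Fp Fn.
(* With [h * N = 2 * r], the errors [3 * e * h] of the N^3 cells add up to 3 m N^2, half of the
   outflow 6 m N^2 forced by the faces. *)
pose e := m / (2 * r).
have e0 : 0 < e by rewrite divr_gt0// mulr_gt0.
have /choice[d dP] : forall i, exists d : R, 0 < d /\ forall x y : 'rV[R]_3,
    (forall j, `|x 0 j| <= r) -> `|y - x| < d ->
    `|derive (F i) y (delta_mx 0 i) - derive (F i) x (delta_mx 0 i)| < e.
  move=> i.
  have [d d0 dP] := near_uniform_on_compact e0 (cF i) (@compact_cube R 3 r).
  by exists d.
pose dm := Num.min (d 0) (Num.min (d 1) (d 2%:R)).
have dm0 : 0 < dm by rewrite !lt_min; have [? _] := dP 0; have [? _] := dP 1;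
  have [-> _] := dP 2%:R; apply/and3P.
have dmi i : dm <= d i.
  by move: i; apply: forall_ord3; rewrite !ge_min lexx ?orbT.
have rd0 : 0 < 2 * r / dm by rewrite divr_gt0// mulr_gt0.
have [N NP] : exists N : nat, 2 * r / dm < N%:R.
  by exists (Num.bound (2 * r / dm)); apply: archi_boundP; exact: ltW.
have N0 : 0 < N%:R :> R by exact: lt_trans NP.
pose h := 2 * r / N%:R.
have h0 : 0 < h by rewrite divr_gt0// mulr_gt0.
have hN : h * N%:R = 2 * r by rewrite divfK// gt_eqF.
have hd : h < dm.
  by rewrite ltr_pdivrMr// [ltRHS]mulrC -ltr_pdivrMr.
(* The intermediate point is within [h < dm] of [x], so the derivative there is within [e] of its
   value at [x]. *)
have step i (x : 'rV[R]_3) : (forall j, `|x 0 j| <= r) ->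
    F i (x + h *: delta_mx 0 i) - F i x <= (derive (F i) x (delta_mx 0 i) + e) * h.
  move=> xr; have [u uh ->] := @MVT_line _ _ (F i) x (delta_mx 0 i) h (dF i).
  rewrite ler_pM2r// -lerBlDl ltW//; apply: le_lt_trans (ler_norm _) _.
  apply: (dP i).2 => //; apply: lt_le_trans (dmi i); apply: le_lt_trans hd.
  rewrite addrAC subrr add0r normrZ -(gtr0_norm h0) -[leRHS]mulr1.
  by rewrite ler_pM// norm_delta_mx.
(* Grid vertices: index 0 lies on the face at [- r], index [N] on the face at [r]. *)
pose P a b c :'rV[R]_3 := vec3 (- r + h * a%:R) (- r + h * b%:R) (- r + h * c%:R).
have hk (a : nat) : (a <= N)%N -> `|- r + h * a%:R| <= r.
  move=> aN; have : h * a%:R <= 2 * r by rewrite -hN ler_pM2l// ler_nat.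
  have : 0 <= h * a%:R by rewrite mulr_ge0// ltW.
  by rewrite ler_norml; lra.
have PK a b c : (a <= N)%N -> (b <= N)%N -> (c <= N)%N ->
    forall j, `|P a b c 0 j| <= r.
  by move=> aN bN cN; apply: forall_ord3; rewrite vec3E hk.
have P0 a b c : P a.+1 b c = P a b c + h *: delta_mx 0 0.
  by apply: row3P; rewrite !mxE/= ?vec3E -?natr1; ring.
have P1 a b c : P a b.+1 c = P a b c + h *: delta_mx 0 1.
  by apply: row3P; rewrite !mxE/= ?vec3E -?natr1; ring.
have P2 a b c : P a b c.+1 = P a b c + h *: delta_mx 0 2%:R.
  by apply: row3P; rewrite !mxE/= ?vec3E -?natr1; ring.
pose G0 a b c := F 0 (P a.+1 b c) - F 0 (P a b c).
pose G1 a b c := F 1 (P a b.+1 c) - F 1 (P a b c).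
pose G2 a b c := F 2%:R (P a b c.+1) - F 2%:R (P a b c).
have hi : - r + h * N%:R = r by rewrite hN; ring.
have lo : - r + h * 0%:R = - r by rewrite mulr0 addr0.
have sum_const (x : R) : \sum_(a < N) \sum_(b < N) x = N%:R * N%:R * x.
  by rewrite !sumr_const !card_ord -mulrnA -[LHS]mulr_natl natrM.
have low0 : N%:R * N%:R * (2 * m) <=
    \sum_(a < N) \sum_(b < N) \sum_(c < N) G0 c a b.
  rewrite -sum_const; apply: ler_sum => a _; apply: ler_sum => b _.
  (* On a grid line only the two end values survive, one at least [m] and the other at most [- m];
     the other two directions are treated alike. *)
  rewrite (telescope_ord (fun c => F 0 (P c a b))).
  have := Fp 0 (P N a b) (PK _ _ _ _ _ _); rewrite vec3E hi !(ltnW (ltn_ord _)) leqnn.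
  move=> /(_ isT isT isT erefl).
  have := Fn 0 (P 0%N a b) (PK _ _ _ _ _ _); rewrite vec3E lo !(ltnW (ltn_ord _)).
  by move=> /(_ isT isT isT erefl); lra.
have low1 : N%:R * N%:R * (2 * m) <=
    \sum_(a < N) \sum_(b < N) \sum_(c < N) G1 a c b.
  rewrite -sum_const; apply: ler_sum => a _; apply: ler_sum => b _.
  rewrite (telescope_ord (fun c => F 1 (P a c b))).
  have := Fp 1 (P a N b) (PK _ _ _ _ _ _); rewrite vec3E hi !(ltnW (ltn_ord _)) leqnn.
  move=> /(_ isT isT isT erefl).
  have := Fn 1 (P a 0%N b) (PK _ _ _ _ _ _); rewrite vec3E lo !(ltnW (ltn_ord _)).
  by move=> /(_ isT isT isT erefl); lra.
have low2 : N%:R * N%:R * (2 * m) <=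
    \sum_(a < N) \sum_(b < N) \sum_(c < N) G2 a b c.
  rewrite -sum_const; apply: ler_sum => a _; apply: ler_sum => b _.
  rewrite (telescope_ord (fun c => F 2%:R (P a b c))).
  have := Fp 2%:R (P a b N) (PK _ _ _ _ _ _); rewrite vec3E hi !(ltnW (ltn_ord _)) leqnn.
  move=> /(_ isT isT isT erefl).
  have := Fn 2%:R (P a b 0%N) (PK _ _ _ _ _ _); rewrite vec3E lo !(ltnW (ltn_ord _)).
  by move=> /(_ isT isT isT erefl); lra.
have cell a b c : (a < N)%N -> (b < N)%N -> (c < N)%N ->
    G0 a b c + G1 a b c + G2 a b c <= 3 * e * h.
  (* The three increments start from the same corner, where the partial derivatives add up to the
     divergence, hence cancel. *)
  move=> /ltnW aN /ltnW bN /ltnW cN; have Pr := PK _ _ _ aN bN cN.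
  have := divF (P a b c); rewrite sum_ord3 => div0.
  have := step 0 _ Pr; have := step 1 _ Pr; have := step 2%:R _ Pr.
  rewrite -P0 -P1 -P2 -/(G0 a b c) -/(G1 a b c) -/(G2 a b c) => s2 s1 s0.
  apply: le_trans (lerD (lerD s0 s1) s2) _.
  rewrite -!mulrDl ler_pM2r//; lra.
have up : \sum_(a < N) \sum_(b < N) \sum_(c < N) (G0 a b c + G1 a b c + G2 a b c)
    <= N%:R * N%:R * (3 * m).
  have -> : 3 * m = N%:R * (3 * e * h).
    by rewrite mulrCA (mulrC N%:R) hN /e; field; rewrite gt_eqF.
  rewrite -sum_const; apply: ler_sum => a _; apply: ler_sum => b _.
  apply: le_trans (_ : \sum_(c < N) 3 * e * h <= _).
    by apply: ler_sum => c _; exact: cell.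
  by rewrite sumr_const card_ord -[leLHS]mulr_natl.
have split_sum : \sum_(a < N) \sum_(b < N) \sum_(c < N)
      (G0 a b c + G1 a b c + G2 a b c) =
    \sum_(a < N) \sum_(b < N) \sum_(c < N) G0 a b c +
    \sum_(a < N) \sum_(b < N) \sum_(c < N) G1 a b c +
    \sum_(a < N) \sum_(b < N) \sum_(c < N) G2 a b c.
  rewrite -!big_split; apply: eq_bigr => a _.
  rewrite -!big_split; apply: eq_bigr => b _.
  by rewrite -!big_split.
(* Reordering that makes the telescoping index innermost. *)
have ex0 : \sum_(a < N) \sum_(b < N) \sum_(c < N) G0 a b c =
    \sum_(a < N) \sum_(b < N) \sum_(c < N) G0 c a b.
  by rewrite exchange_big; apply: eq_bigr => a _; rewrite exchange_big.
have ex1 : \sum_(a < N) \sum_(b < N) \sum_(c < N) G1 a b c =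
    \sum_(a < N) \sum_(b < N) \sum_(c < N) G1 a c b.
  by apply: eq_bigr => a _; rewrite exchange_big.
have : N%:R * N%:R * m > 0 by rewrite !mulr_gt0.
move: up; rewrite split_sum ex0 ex1; lra.
Qed.

(** * Scalar functions with continuous partial derivatives: differentiability and closure
    properties *)

Definition C1_fun (R : realType) (n : nat) (f : 'rV[R]_n -> R) : Prop :=
  forall i, (forall x, derivable f x (delta_mx 0 i)) /\
    continuous (fun x => derive f x (delta_mx 0 i)).

(** The second argument is the variable: [dot a] is a linear form, to serve as the differential of a
    function with gradient [a]. *)
Definition dot (R : realType) (n : nat) (a v : 'rV[R]_n) : R :=
  \sum_i v 0 i * a 0 i.

Lemma dot_is_linear (R : realType) (n : nat) (a : 'rV[R]_n) : linear (dot a).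
Proof.
move=> k u v; rewrite /dot scaler_sumr -big_split; apply: eq_bigr => i _.
by rewrite !mxE mulrDl -mulrA.
Qed.

HB.instance Definition _ (R : realType) (n : nat) (a : 'rV[R]_n) :=
  GRing.isLinear.Build R 'rV[R]_n R _ (dot a) (@dot_is_linear R n a).

Lemma coord_le_norm (R : realType) (n : nat) (v : 'rV[R]_n) (i : 'I_n) :
  `|v 0 i| <= `|v|.
Proof.
rewrite [leRHS]/Num.Def.normr/= mx_normrE.
exact: (le_bigmax _ (fun ij => `|v ij.1 ij.2|) (0, i)).
Qed.

Lemma norm_le_coord (R : realType) (n : nat) (v : 'rV[R]_n) (r : R) :
  0 <= r -> (forall i, `|v 0 i| <= r) -> `|v| <= r.
Proof.
move=> r0 vr; rewrite [leLHS]/Num.Def.normr/= mx_normrE.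
by apply: bigmax_le => // -[a b] _ /=; rewrite (ord1 a).
Qed.

Lemma continuous_dot (R : realType) (n : nat) (a : 'rV[R]_n) : continuous (dot a).
Proof.
apply: continuous_big; [exact: add_continuous|move=> i _ v].
by apply: continuousM; [exact: coord_continuous|exact: cst_continuous].
Qed.

Lemma continuous_addf (R : realType) (T : topologicalType) (f g : T -> R) :
  continuous f -> continuous g -> continuous (fun x => f x + g x).
Proof. by move=> cf cg x; apply: cvgD; [exact: cf|exact: cg]. Qed.

Lemma continuous_mulf (R : realType) (T : topologicalType) (f g : T -> R) :
  continuous f -> continuous g -> continuous (fun x => f x * g x).
Proof. by move=> cf cg x; apply: cvgM; [exact: cf|exact: cg]. Qed.

Lemma continuous_rowP (R : realType) (T : topologicalType) (m : nat)
    (F : T -> 'rV[R]_m) :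
  (forall j, continuous (fun x => F x 0 j)) -> continuous F.
Proof.
move=> cF x; apply/cvgrPdist_lt => e e0.
have e20 : 0 < e / 2 by rewrite divr_gt0.
have : \forall y \near x, forall j, `|F x 0 j - F y 0 j| < e / 2.
  apply: (@filter_forall _ _ (fun j y => `|F x 0 j - F y 0 j| < e / 2) (nbhs x)) => j.
  by have /cvgrPdist_lt /(_ _ e20) := cF j x.
apply: filterS => y h; apply: le_lt_trans (_ : e / 2 < e).
  apply: norm_le_coord; first exact: ltW.
  by move=> j; rewrite !mxE ltW.
by rewrite ltr_pdivrMr// mulr_natr mulr2n ltrDl.
Qed.

(** Go from [x] to [x + v] along the coordinate axes, one at a time, and apply the mean value
    theorem to each leg; continuity of the partial derivatives bounds the error of each leg. *)
Lemma C1_fun_estimate (R : realType) (n : nat) (f : 'rV[R]_n -> R) (x : 'rV[R]_n)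
    (e : R) : C1_fun f -> 0 < e ->
  \forall v \near (0 : 'rV[R]_n),
   `|f (x + v) - f x - dot (\row_i derive f x (delta_mx 0 i)) v| <= e * `|v|.
Proof.
(* One share of [e] for each of the [n] legs; the successor keeps the division meaningful when [n]
   is 0. *)
move=> f1 e0; pose e' := e / n.+1%:R.
have e'0 : 0 < e' by rewrite divr_gt0.
have : \forall z \near x, forall i, `|derive f z (delta_mx 0 i) -
    derive f x (delta_mx 0 i)| < e'.
  apply: (@filter_forall _ _ (fun i z => `|derive f z (delta_mx 0 i) -
    derive f x (delta_mx 0 i)| < e') (nbhs x)) => i.
  have /cvgrPdist_lt /(_ _ e'0) := (f1 i).2 x.
  by apply: filterS => z; rewrite distrC.
move=> /nbhs_normP[d /= d0 dP].
apply/nbhs_normP; exists d => //= v; rewrite /= sub0r normrN => vd.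
(* The broken line from 0 to [v]: [w k] keeps the first [k] coordinates of [v]. *)
pose w (k : nat) : 'rV[R]_n := \row_i (if (i < k)%N then v 0 i else 0).
have wS (i : 'I_n) : w i.+1 = w i + v 0 i *: delta_mx 0 i.
  apply/rowP => j; rewrite !mxE eqxx/= ltnS.
  case: (ltngtP j i) => [ji|ji|/val_inj ->].
  - by rewrite (_ : (j == i) = false) ?mulr0 ?addr0//; apply/eqP => ij; rewrite ij ltnn in ji.
  - by rewrite (_ : (j == i) = false) ?mulr0 ?addr0//; apply/eqP => ij; rewrite ij ltnn in ji.
  - by rewrite eqxx mulr1 add0r.
have w0 : w 0%N = 0 by apply/rowP => j; rewrite !mxE.
have wn : w n = v by apply/rowP => j; rewrite !mxE ltn_ord.
have -> : f (x + v) - f x = \sum_(i < n) (f (x + w i.+1) - f (x + w i)).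
  by rewrite (telescope_ord (fun k => f (x + w k))) wn w0 addr0.
rewrite /dot -sumrB; apply: le_trans (ler_norm_sum _ _ _) _.
apply: le_trans (_ : \sum_(i < n) e' * `|v| <= _); last first.
  rewrite sumr_const card_ord -[leLHS]mulr_natl mulrA ler_wpM2r//.
  rewrite /e' mulrCA -[leRHS]mulr1 ler_wpM2l ?(ltW e0)// ler_pdivrMr// mul1r.
  by rewrite ler_nat.
apply: ler_sum => i _; rewrite mxE wS addrA.
have [u uv ->] := @MVT_line _ _ f (x + w i) (delta_mx 0 i) (v 0 i) (f1 i).1.
rewrite mulrC -mulrBr normrM mulrC ler_pM ?coord_le_norm// ltW// dP//=.
(* The intermediate point differs from [x] by a vector with entries those of [v] before [i], [u] at
   [i] and 0 beyond, so its sup norm is at most that of [v]. *)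
rewrite distrC addrAC [x + w i]addrC addrK (le_lt_trans _ vd)//.
apply: norm_le_coord => // j; rewrite !mxE/=.
case: (ltngtP j i) => [ji|ji|/val_inj ->].
- rewrite (_ : (j == i) = false) ?mulr0 ?addr0 ?coord_le_norm//.
  by apply/eqP => ij; rewrite ij ltnn in ji.
- rewrite (_ : (j == i) = false) ?mulr0 ?addr0 ?normr0//.
  by apply/eqP => ij; rewrite ij ltnn in ji.
- by rewrite eqxx mulr1 add0r (le_trans uv)// coord_le_norm.
Qed.

(** [C1_fun_estimate] is a first-order expansion with little-o remainder, and the differential is
    unique. *)
Lemma C1_fun_diff (R : realType) (n : nat) (f : 'rV[R]_n -> R) (x : 'rV[R]_n) :
  C1_fun f -> is_diff x f (dot (\row_i derive f x (delta_mx 0 i))).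
Proof.
move=> f1; set a := \row_i _.
have E : f \o shift x = cst (f x) + dot a +o_ (0 : 'rV[R]_n) id.
  apply/eqaddoP => e e0; have := C1_fun_estimate x f1 e0.
  apply: filterS => v.
  have -> : (f \o shift x - (cst (f x) + dot a)) v = f (v + x) - (f x + dot a v).
    by [].
  by rewrite opprD addrA (addrC v).
have dE := diff_unique (@continuous_dot _ _ a) E.
apply: DiffDef => //; apply/diff_locallyP; rewrite dE; split => //.
exact: continuous_dot.
Qed.

Lemma C1_fun_continuous (R : realType) (n : nat) (f : 'rV[R]_n -> R) :
  C1_fun f -> continuous f.
Proof. by move=> f1 x; apply: differentiable_continuous; have [] := C1_fun_diff x f1. Qed.

Lemma C1_fun_of_is_derive (R : realType) (n : nat) (f : 'rV[R]_n -> R)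
    (df : 'I_n -> 'rV[R]_n -> R) :
  (forall i x, is_derive x (delta_mx 0 i) f (df i x)) ->
  (forall i, continuous (df i)) -> C1_fun f.
Proof.
move=> fdf cdf i; split=> [x|]; first by case: (fdf i x).
rewrite (_ : (fun x => _) = df i)//.
by apply/funext => x; case: (fdf i x).
Qed.

Lemma C1_funD (R : realType) (n : nat) (f g : 'rV[R]_n -> R) :
  C1_fun f -> C1_fun g -> C1_fun (fun x => f x + g x).
Proof.
move=> f1 g1; apply: (@C1_fun_of_is_derive _ _ _ (fun i x =>
  derive f x (delta_mx 0 i) + derive g x (delta_mx 0 i))).
  move=> i x; have /derivableP ? := (f1 i).1 x; have /derivableP ? := (g1 i).1 x.
  exact: is_deriveD.
by move=> i; apply: continuous_addf; [exact: (f1 i).2|exact: (g1 i).2].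
Qed.

Lemma C1_funM (R : realType) (n : nat) (f g : 'rV[R]_n -> R) :
  C1_fun f -> C1_fun g -> C1_fun (fun x => f x * g x).
Proof.
move=> f1 g1; apply: (@C1_fun_of_is_derive _ _ _ (fun i x =>
  f x * derive g x (delta_mx 0 i) + g x * derive f x (delta_mx 0 i))).
  move=> i x; have /derivableP ? := (f1 i).1 x; have /derivableP ? := (g1 i).1 x.
  exact: is_deriveM.
by move=> i; apply: continuous_addf; apply: continuous_mulf;
  [exact: C1_fun_continuous|exact: (g1 i).2|
   exact: C1_fun_continuous|exact: (f1 i).2].
Qed.

Lemma C1_fun_cst (R : realType) (n : nat) (k : R) :
  C1_fun (fun _ : 'rV[R]_n => k).
Proof.
apply: (@C1_fun_of_is_derive _ _ _ (fun _ _ => 0)) => i.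
exact: cst_continuous.
Qed.

Lemma C1_funB (R : realType) (n : nat) (f g : 'rV[R]_n -> R) :
  C1_fun f -> C1_fun g -> C1_fun (fun x => f x - g x).
Proof.
move=> f1 g1.
rewrite (_ : (fun x => _) = (fun x => f x + (fun y => -1 * g y) x)).
  by apply: C1_funD => //; apply: C1_funM => //; exact: C1_fun_cst.
by apply/funext => x; rewrite mulN1r.
Qed.

Lemma is_derive_coord (R : realType) (n : nat) (j : 'I_n) (x v : 'rV[R]_n) :
  is_derive x v (fun y : 'rV[R]_n => y 0 j) (v 0 j).
Proof.
have [dx xE] := is_derive_id x v.
have /derivable_mxP /(_ 0 j) dj := dx; split => //.
by have := derive_mx dx; rewrite xE => /matrixP /(_ 0 j); rewrite mxE.
Qed.

Lemma C1_fun_coord (R : realType) (n : nat) (j : 'I_n) :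
  C1_fun (fun x : 'rV[R]_n => x 0 j).
Proof.
apply: (@C1_fun_of_is_derive _ _ _ (fun i _ => (delta_mx 0 i : 'rV[R]_n) 0 j)) => i x.
  exact: is_derive_coord.
exact: cst_continuous.
Qed.

Lemma partial_coord (R : realType) (n m : nat) (F : 'rV[R]_n -> 'rV[R]_m)
    (i : 'I_n) (j : 'I_m) (x : 'rV[R]_n) :
  derivable F x (delta_mx 0 i) ->
  is_derive x (delta_mx 0 i) (fun y => F y 0 j) (partial i F x 0 j).
Proof.
move=> dF; have /derivable_mxP /(_ 0 j) dj := dF; split => //.
by rewrite /partial (derive_mx dF) mxE.
Qed.

(** Through this, regularity of [curl] and [cross] reduces to sums and products of scalar
    functions. *)
Lemma C1P (R : realType) (n m : nat) (F : 'rV[R]_n -> 'rV[R]_m) :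
  C1 F <-> forall j, C1_fun (fun x => F x 0 j).
Proof.
split=> [F1 j|F1 i].
  apply: (@C1_fun_of_is_derive _ _ _ (fun i x => partial i F x 0 j)) => i x.
    exact: partial_coord ((F1 i).1 x).
  apply: (@continuous_comp _ _ _ (partial i F) (fun M : 'rV[R]_m => M 0 j)).
    exact: (F1 i).2.
  exact: coord_continuous.
have dF x : derivable F x (delta_mx 0 i).
  by apply/derivable_mxP => a j; rewrite (ord1 a); exact: (F1 j i).1.
split => //; apply: continuous_rowP => j.
rewrite (_ : (fun x => _) = (fun x => derive (fun y => F y 0 j) x (delta_mx 0 i))).
  exact: (F1 j i).2.
by apply/funext => x; case: (partial_coord j (dF x)).
Qed.

(** * Derivatives, curl and Hall term under affine rescaling *)

Lemma cvg_dnbhs0_mul (R : realType) (mu : R) : mu != 0 ->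
  mu * h @[h --> 0^'] --> (0 : R)^'.
Proof.
move=> mu0 A /nbhs_ballP[d /= d0 dA]; apply/nbhs_ballP.
exists (d / `|mu|); first by rewrite /= divr_gt0// normr_gt0.
move=> h; rewrite /ball/= sub0r normrN ltr_pdivlMr ?normr_gt0// => hd h0.
apply: dA; last by rewrite mulf_neq0.
by rewrite /ball/= sub0r normrN normrM mulrC.
Qed.

Lemma cvg_dnbhs_shift (R : realType) (t : R) : h + t @[h --> 0^'] --> t^'.
Proof.
move=> A /nbhs_ballP[d /= d0 dA]; apply/nbhs_ballP; exists d => //= h.
rewrite /ball/= sub0r normrN => hd h0; apply: dA.
  by rewrite /ball/= opprD addrCA subrr addr0 normrN.
by rewrite -subr_eq0 addrK.
Qed.

(** The difference quotient at [h] is [k * mu] times that of [F] at [mu * h], which tends to 0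
    without vanishing. *)
Lemma is_derive_rescale (R : realType) (V W : normedModType R) (F : V -> W)
    (k mu : R) (x0 x v : V) :
  mu != 0 -> derivable F (mu *: (x - x0)) v ->
  is_derive x v (fun z => k *: F (mu *: (z - x0)))
    ((k * mu) *: derive F (mu *: (x - x0)) v).
Proof.
move=> mu0 dF; set y := mu *: (x - x0).
pose G (h : R) := h^-1 *: (F (h *: v + y) - F y).
have E : (fun h : R => h^-1 *: (k *: F (mu *: (h *: v + x - x0)) - k *: F y)) =
    (fun h => (k * mu) *: G (mu * h)).
  apply/funext => h; rewrite /G -scalerBr !scalerA.
  have -> : mu *: (h *: v + x - x0) = (mu * h) *: v + y.
    by rewrite -addrA scalerDr scalerA.
  by congr (_ *: _); rewrite invfM [k * mu * _]mulrA mulfK// mulrC.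
have cG : (k * mu) *: G (mu * h) @[h --> 0^'] --> (k * mu) *: derive F y v.
  have cGmu : G (mu * h) @[h --> 0^'] --> derive F y v.
    exact: (cvg_comp (fun h => mu * h) G (cvg_dnbhs0_mul mu0) dF).
  exact: (cvgZl_tmp (k := k * mu) cGmu).
by split; rewrite /derivable /derive /= -/y E; [apply: cvgP cG|apply: cvg_lim].
Qed.

Lemma curl_near_eq (R : realType) (F G : 'rV[R]_3 -> 'rV[R]_3) (x : 'rV[R]_3) :
  (\forall z \near x, F z = G z) -> curl F x = curl G x.
Proof. by move=> FG; rewrite /curl /partial !(near_eq_derive _ FG). Qed.

Lemma curl_rescale (R : realType) (F : 'rV[R]_3 -> 'rV[R]_3) (k mu : R)
    (x0 x : 'rV[R]_3) : mu != 0 ->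
  (forall i, derivable F (mu *: (x - x0)) (delta_mx 0 i)) ->
  curl (fun z => k *: F (mu *: (z - x0))) x =
    (k * mu) *: curl F (mu *: (x - x0)).
Proof.
move=> mu0 dF; rewrite /curl /partial.
rewrite !(@derive_val _ _ _ _ _ _ _ (is_derive_rescale k mu0 (dF _))).
move: (derive F _ _) (derive F _ _) (derive F _ _) => D1 D2 D0.
by apply: row3P; rewrite !mxE/= ?mxE; ring.
Qed.

Lemma crossZ (R : realType) (a b : R) (u v : 'rV[R]_3) :
  cross (a *: u) (b *: v) = (a * b) *: cross u v.
Proof. by apply: row3P; rewrite !mxE/= ?mxE; ring. Qed.

Lemma C1_curl (R : realType) (F : 'rV[R]_3 -> 'rV[R]_3) : C2 F -> C1 (curl F).
Proof.
move=> [F1 F2]; apply/C1P; have F2' i := (C1P _).1 (F2 i).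
by apply: forall_ord3; under eq_fun do rewrite vec3E; exact: C1_funB.
Qed.

Lemma C1_cross (R : realType) (F G : 'rV[R]_3 -> 'rV[R]_3) :
  C1 F -> C1 G -> C1 (fun x => cross (F x) (G x)).
Proof.
move=> /C1P F1 /C1P G1; apply/C1P.
by apply: forall_ord3; under eq_fun do rewrite vec3E; apply: C1_funB; exact: C1_funM.
Qed.

(** Each of the two curls brings a factor [mu] and each of the two occurrences of the field a factor
    [k]. Equality near [x] is the right hypothesis, since [B] has its self-similar form only in a
    ball. *)
Lemma hall_rescale (R : realType) (B H : 'rV[R]_3 -> 'rV[R]_3) (k mu : R)
    (x0 x : 'rV[R]_3) : mu != 0 -> C2 H ->
  (\forall z \near x, B z = k *: H (mu *: (z - x0))) ->
  hall B x = (k * mu) ^+ 2 *: hall H (mu *: (x - x0)).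
Proof.
move=> mu0 H2 BH; have [H1 _] := H2.
have E1 : C1 (fun x => cross (curl H x) (H x)).
  exact: (C1_cross (C1_curl H2) H1).
rewrite /hall (@curl_near_eq _ _ (fun z => (k * mu * k) *:
    cross (curl H (mu *: (z - x0))) (H (mu *: (z - x0))))).
  rewrite (curl_rescale (F := fun y => cross (curl H y) (H y)))//.
    by congr (_ *: _); ring.
  by move=> i; exact: (E1 i).1.
(* The outer curl needs the inner one on a neighbourhood of [x], hence the equality near each [z]
   close to [x]. *)
move: BH => /near_join; apply: filterS => z BHz.
rewrite (curl_near_eq BHz) curl_rescale//; last by move=> i; exact: (H1 i).1.
by rewrite (nbhs_singleton BHz) crossZ.
Qed.

(** * From the self-similar form to the profile equation *)

Lemma is_derive_C1_comp (R : realType) (n : nat) (f : 'rV[R]_n -> R)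
    (g : R -> 'rV[R]_n) (t : R) (dg : 'rV[R]_n) :
  C1_fun f -> is_derive t 1 g dg ->
  is_derive t (1 : R) (fun s => f (g s))
    (dot (\row_i derive f (g t) (delta_mx 0 i)) dg).
Proof.
move=> f1 [/derivable1_diffP dgt gE]; have [dft fE] := C1_fun_diff (g t) f1.
have dfg : differentiable (f \o g) t by exact: differentiable_comp.
split; first exact: diff_derivable.
by rewrite (deriveE _ dfg) diff_comp//= -(deriveE _ dgt) gE fE.
Qed.

Lemma is_derive_powR_reflect (R : realType) (T t a : R) : t < T ->
  is_derive t (1 : R) (fun s => (T - s) `^ (- a)) (a * (T - t) `^ (- a - 1)).
Proof.
move=> tT; have Tt : 0 < T - t by rewrite subr_gt0.
have dl : is_derive t (1 : R) (fun s => T - s) (- 1).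
  have := is_deriveB (is_derive_cst T t (1 : R)) (is_derive_id t (1 : R)).
  by rewrite sub0r.
have := @is_derive1_comp R (fun x => x `^ (- a)) (fun s => T - s) t _ _
  (is_derive1_powR (- a) Tt) dl.
by rewrite mulrN1 mulNr opprK.
Qed.

(** The time derivative of the rescaled point is b y / (T - t), so the chain rule yields y . grad f
    with the same power of T - t as the term coming from the prefactor. *)
Lemma is_derive_self_similar (R : realType) (n : nat) (f : 'rV[R]_n -> R)
    (T t a b : R) (w : 'rV[R]_n) (y := ((T - t) `^ b)^-1 *: w) :
  C1_fun f -> t < T ->
  is_derive t (1 : R)
    (fun s => ((T - s) `^ a)^-1 * f (((T - s) `^ b)^-1 *: w))
    ((T - t) `^ (- a - 1) *
      (a * f y + b * dot (\row_i derive f y (delta_mx 0 i)) y)).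
Proof.
move=> f1 tT; have Tt : 0 < T - t by rewrite subr_gt0.
have dq : is_derive t (1 : R) (fun s => ((T - s) `^ (- b)) *: w)
    ((b * (T - t) `^ (- b - 1)) *: w).
  have [/derivable1_diffP d1 d2] := is_derive_powR_reflect b tT.
  split; first by apply/derivable1_diffP; exact: differentiableZl.
  by rewrite deriveE ?diffZl//; [rewrite -deriveE// d2|exact: differentiableZl].
have dfq := is_derive_C1_comp f1 dq.
have := is_deriveM (is_derive_powR_reflect a tT) dfq.
rewrite -(powRN _ b) in y *.
rewrite (_ : (fun s => _) * _ = (fun s => ((T - s) `^ a)^-1 * f (((T - s) `^ b)^-1 *: w))).
  move=> d; apply: (is_derive_eq d).
  have E c : (T - t) `^ (c - 1) = (T - t) `^ c * (T - t)^-1.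
    rewrite powRD; last by rewrite (gt_eqF Tt) implybT.
    by rewrite powR_inv1// ltW.
  rewrite -/y !E; have -> : w = (T - t) `^ b *: y.
    by rewrite /y scalerA powRN mulfV ?scale1r// gt_eqF// powR_gt0.
  rewrite scalerA linearZ /= !powRN /GRing.scale/=.
  have ? : T - t != 0 by rewrite gt_eqF.
  have ? : (T - t) `^ b != 0 by rewrite gt_eqF// powR_gt0.
  have ? : (T - t) `^ a != 0 by rewrite gt_eqF// powR_gt0.
  by field; apply/and3P.
by apply/funext => s /=; rewrite -!powRN.
Qed.

(** At an interior time the half-open interval is a neighbourhood of [t], so the restricted limit is
    the ordinary two-sided derivative. *)
Lemma dnbhs_within_cvg (R : realType) (t0 T t : R) (V : normedModType R)
    (g : R -> V) (l : V) : t0 < t < T ->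
  (s - t)^-1 *: (g s - g t) @[s --> within `[t0, T[ t^'] --> l ->
  h^-1 *: (g (h + t) - g t) @[h --> 0^'] --> l.
Proof.
move=> /andP[t0t tT] gl.
have gl' : (s - t)^-1 *: (g s - g t) @[s --> t^'] --> l.
  move=> A /gl AD.
  have tI : t \in `]t0, T[ by rewrite in_itv/= t0t.
  have D : \forall s \near t^', s \in `]t0, T[.
    by have := near_in_itvoo tI; apply: filterS => s sI _.
  have AD' : \forall s \near t^', s \in `[t0, T[ -> A ((s - t)^-1 *: (g s - g t)).
    exact: AD.
  apply: filterS2 AD' D => s + sI; apply.
  by move: sI; rewrite /= !in_itv/= => /andP[/ltW -> ->].
have := cvg_comp (fun h => h + t) (fun s => (s - t)^-1 *: (g s - g t))
  (@cvg_dnbhs_shift R t) gl'.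
rewrite (_ : _ \o _ = (fun h => h^-1 *: (g (h + t) - g t)))//.
by apply/funext => h /=; rewrite addrK.
Qed.

Lemma enormZ (R : realType) (n : nat) (k : R) (x : 'rV[R]_n) :
  enorm (k *: x) = `|k| * enorm x.
Proof.
rewrite /enorm -sqrtr_sqr -sqrtrM ?sqr_ge0// mulr_sumr; congr (Num.sqrt _).
by apply: eq_bigr => i _; rewrite mxE exprMn.
Qed.

Lemma continuous_enorm (R : realType) (T : topologicalType) (n : nat)
    (g : T -> 'rV[R]_n) :
  (forall i, continuous (fun x => g x 0 i)) -> continuous (fun x => enorm (g x)).
Proof.
move=> cg x; apply: (continuous_comp (f := fun x => \sum_(i < n) g x 0 i ^+ 2)).
  apply: continuous_big; [exact: add_continuous|move=> i _].
  by apply: continuous_mulf.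
exact: sqrt_continuous.
Qed.

Lemma near_eball (R : realType) (n : nat) (x0 x : 'rV[R]_n) (r : R) :
  eball x0 r x -> \forall z \near x, eball x0 r z.
Proof.
have c : continuous (fun z : 'rV[R]_n => enorm (z - x0)).
  apply: continuous_enorm => i.
  rewrite (_ : (fun z => _) = (fun z : 'rV[R]_n => z 0 i + - x0 0 i)).
    by apply: continuous_addf; [exact: coord_continuous|exact: cst_continuous].
  by apply/funext => z; rewrite !mxE.
by move=> xr; exact: (cvgr_lt _ (c x) _ xr).
Qed.

(** The value of [H] at [y] is seen by [B] at x0 + (T - t)^b y, which lies in the ball once [t] is
    close to [T]. The same power of T - t then factors out of the whole evolution equation. *)
Lemma profile_equation (R : realType) (alpha t0 T rho0 : R) (x0 : 'rV[R]_3)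
    (B : 'rV[R]_3 -> R -> 'rV[R]_3) (H : 'rV[R]_3 -> 'rV[R]_3)
    (y : 'rV[R]_3) (j : 'I_3) :
  - 2 < alpha -> t0 < T -> 0 < rho0 ->
  classical_solution t0 T B -> locally_self_similar alpha t0 T rho0 x0 B H ->
  C2 H ->
  alpha / (alpha + 2) * H y 0 j +
  1 / (alpha + 2) *
    dot (\row_i derive (fun z => H z 0 j) y (delta_mx 0 i)) y +
  hall H y 0 j = 0.
Proof.
move=> alpha2 t0T rho00 [Bt [dB _ _ pde _]] BH H2.
set a := alpha / _; set b := 1 / _.
have al2 : 0 < alpha + 2 by lra.
have b0 : 0 < b by rewrite divr_gt0.
(* This makes the powers agree: the Hall term scales as tau^(-2a - 2b), the time derivative as
   tau^(-a - 1). *)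
have ab : a + 2 * b = 1 by rewrite /a /b; field; rewrite gt_eqF.
have Hj : C1_fun (fun z => H z 0 j) by exact: (C1P _).1 H2.1 j.
have y0 : 0 <= enorm y by exact: sqrtr_ge0.
(* If tau^b is at most [q], then tau^b y has norm below [rho0]; the added 1 makes this strict and
   covers [y = 0]. *)
pose q := rho0 / (enorm y + 1).
have q0 : 0 < q by rewrite divr_gt0// ltr_wpDl.
(* The first bound keeps [T - tau] after [t0], the second gives tau^b at most [q]. *)
pose tau := Num.min ((T - t0) / 2) (q `^ b^-1).
have tau0 : 0 < tau by rewrite lt_min powR_gt0// divr_gt0// subr_gt0.
have tauq : tau `^ b <= q.
  rewrite -[leRHS](_ : (q `^ b^-1) `^ b = q); last first.
    by rewrite -powRrM mulVf ?gt_eqF// powRr1// ltW.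
  by rewrite ge0_ler_powR ?nnegrE ?powR_ge0 ?(ltW tau0) ?(ltW b0)// ge_min lexx orbT.
have taub0 : 0 < tau `^ b by exact: powR_gt0.
pose t := T - tau.
have Tt : T - t = tau by rewrite /t opprB addrCA subrr addr0.
have t0tT : t0 < t < T.
  have : tau <= (T - t0) / 2 by rewrite ge_min lexx.
  by rewrite /t; move: tau0 t0T; clear; move=> ? ? ?; apply/andP; split; lra.
have tT : t < T by case/andP: t0tT.
have t0t : t0 <= t < T by case/andP: t0tT => /ltW -> ->.
pose x := x0 + tau `^ b *: y.
have xx0 : x - x0 = tau `^ b *: y by rewrite /x addrAC subrr add0r.
have yE : (tau `^ b)^-1 *: (x - x0) = y.
  by rewrite xx0 scalerA mulVf ?scale1r// gt_eqF.
have xB : eball x0 rho0 x.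
  rewrite /eball/= xx0 enormZ gtr0_norm//.
  apply: le_lt_trans (_ : q * enorm y < _); first by rewrite ler_wpM2r.
  by rewrite /q mulrAC ltr_pdivrMr ?ltr_wpDl// ltr_pM2l// ltrDl.
have cBt : h^-1 *: (B x (h + t) 0 j - B x t 0 j) @[h --> 0^'] --> Bt x t 0 j.
  apply: (@dnbhs_within_cvg R t0 T t R (fun s => B x s 0 j)) => //.
  have := cvg_comp _ (fun M : 'rV[R]_3 => M 0 j) (dB x t t0t)
    (@coord_continuous _ _ _ 0 j (Bt x t)).
  rewrite (_ : _ \o _ = fun s => (s - t)^-1 *: (B x s 0 j - B x t 0 j))//.
  by apply/funext => s /=; rewrite !mxE.
have dphi := is_derive_self_similar a b (x - x0) Hj tT.
rewrite Tt yE in dphi.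
have tI : t \in `]t0, T[ by rewrite in_itv/= t0tT.
(* At the fixed point [x] the self-similar formula holds for all times near [t], so it has the same
   time derivative as [B]. *)
have phiB : \forall s \near t, ((T - s) `^ a)^-1 *
    H (((T - s) `^ b)^-1 *: (x - x0)) 0 j = B x s 0 j.
  apply: filterS (near_in_itvoo tI) => s; rewrite in_itv/= => sI.
  by rewrite BH ?mxE// inE.
have [_ dE] := near_eq_is_derive phiB dphi.
have BtE : Bt x t 0 j = tau `^ (- a - 1) * (a * H y 0 j + b *
    dot (\row_i derive (fun z => H z 0 j) y (delta_mx 0 i)) y).
  rewrite -dE; apply/esym/cvg_lim => //.
  rewrite (_ : (fun h => _) = fun h => h^-1 *: (B x (h + t) 0 j - B x t 0 j))//.
  by apply/funext => h /=; rewrite [h *: 1]mulr1.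
have hallE : hall (B ^~ t) x = tau `^ (- a - 1) *: hall H y.
  have mu0 : (tau `^ b)^-1 != 0 by rewrite invr_eq0 gt_eqF.
  have BHx : \forall z \near x,
      B z t = (tau `^ a)^-1 *: H ((tau `^ b)^-1 *: (z - x0)).
    by apply: filterS (near_eball xB) => z zB; rewrite BH ?Tt ?inE.
  rewrite (hall_rescale mu0 H2 BHx).
  rewrite yE -invfM -powRD; last by rewrite (gt_eqF tau0) implybT.
  congr (_ *: _); rewrite -powRN -powR_mulrn ?powR_ge0// -powRrM.
  by congr (_ `^ _); move: ab; lra.
have := pde x t t0t; rewrite hallE => /(congr1 (fun M : 'rV[R]_3 => M 0 j)).
rewrite mxE BtE !mxE -mulrDr => /eqP; rewrite mulf_eq0 gt_eqF ?powR_gt0//=.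
by move=> /eqP.
Qed.

(** * Euclidean norm, cross product and the energy flux *)

Lemma enorm_sqr (R : realType) (u : 'rV[R]_3) :
  enorm u ^+ 2 = u 0 0 ^+ 2 + u 0 1 ^+ 2 + u 0 2%:R ^+ 2.
Proof. by rewrite /enorm sqr_sqrtr ?sum_ord3// !addr_ge0// sqr_ge0. Qed.

Lemma enorm_ge0 (R : realType) (n : nat) (u : 'rV[R]_n) : 0 <= enorm u.
Proof. exact: sqrtr_ge0. Qed.

Lemma coord_le_enorm (R : realType) (n : nat) (u : 'rV[R]_n) (i : 'I_n) :
  `|u 0 i| <= enorm u.
Proof.
rewrite -sqrtr_sqr /enorm ler_wsqrtr// (bigD1 i)//= lerDl sumr_ge0// => j _.
exact: sqr_ge0.
Qed.

(** The constant 2 is a simple upper bound for the square root of 3. *)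
Lemma enorm_le_coord (R : realType) (u : 'rV[R]_3) (r : R) :
  (forall i, `|u 0 i| <= r) -> enorm u <= 2 * r.
Proof.
move=> ur; have r0 : 0 <= r by apply: le_trans (ur 0); exact: normr_ge0.
have sq i : u 0 i ^+ 2 <= r ^+ 2.
  by rewrite -real_normK ?num_real// ler_sqr ?nnegrE.
rewrite -(@ler_pXn2r _ 2)// ?nnegrE ?enorm_ge0 ?mulr_ge0// enorm_sqr.
have := sq 0; have := sq 1; have := sq 2%:R; have := sqr_ge0 r.
rewrite exprMn; lra.
Qed.

(** Lagrange's identity: |u|^2 |v|^2 - |u x v|^2 = (u . v)^2. *)
Lemma enorm_cross (R : realType) (u v : 'rV[R]_3) :
  enorm (cross u v) <= enorm u * enorm v.
Proof.
rewrite -(@ler_pXn2r _ 2)// ?nnegrE ?mulr_ge0 ?enorm_ge0// exprMn !enorm_sqr.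
rewrite /cross !vec3E -subr_ge0.
set d := (X in 0 <= X).
have -> : d = (u 0 0 * v 0 0 + u 0 1 * v 0 1 + u 0 2%:R * v 0 2%:R) ^+ 2.
  by rewrite /d; ring.
exact: sqr_ge0.
Qed.

Lemma dot3 (R : realType) (a v : 'rV[R]_3) :
  dot a v = v 0 0 * a 0 0 + v 0 1 * a 0 1 + v 0 2%:R * a 0 2%:R.
Proof. exact: sum_ord3. Qed.

(** The field |H|^2 y / 7 + (J x H) x H with J = curl H; |H|^2 is spelled out in products so that
    the product rules apply to it. *)
Definition energy_flux (R : realType) (H : 'rV[R]_3 -> 'rV[R]_3) (i : 'I_3)
    (y : 'rV[R]_3) : R :=
  7^-1 * (y 0 i * (H y 0 0 * H y 0 0 + H y 0 1 * H y 0 1 +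
    H y 0 2%:R * H y 0 2%:R)) + cross (cross (curl H y) (H y)) (H y) 0 i.

Lemma C1_energy_flux (R : realType) (H : 'rV[R]_3 -> 'rV[R]_3) (i : 'I_3) :
  C2 H -> C1_fun (energy_flux H i).
Proof.
move=> H2; have H1 := H2.1; have /C1P Hj := H1.
have /C1P Ei := C1_cross (C1_cross (C1_curl H2) H1) H1.
apply: C1_funD; last exact: Ei.
apply: C1_funM; first exact: C1_fun_cst.
apply: C1_funM; first exact: C1_fun_coord.
by apply: C1_funD; [apply: C1_funD|]; exact: C1_funM.
Qed.

Lemma is_derive_cross (R : realType) (V : normedModType R) (F G : V -> 'rV[R]_3)
    (x v : V) (dF dG : 'rV[R]_3) :
  (forall k, is_derive x v (fun z => F z 0 k) (dF 0 k)) ->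
  (forall k, is_derive x v (fun z => G z 0 k) (dG 0 k)) ->
  forall k, is_derive x v (fun z => cross (F z) (G z) 0 k)
    ((cross dF (G x) + cross (F x) dG) 0 k).
Proof.
move=> F' G'.
have M i j := is_deriveM (F' i) (G' j).
have B i j := is_deriveB (M i j) (M j i).
apply: forall_ord3; under eq_fun do rewrite vec3E; rewrite mxE !vec3E.
- by apply: (is_derive_eq (B 1 2%:R)); rewrite /GRing.scale/=; ring.
- by apply: (is_derive_eq (B 2%:R 0)); rewrite /GRing.scale/=; ring.
- by apply: (is_derive_eq (B 0 1)); rewrite /GRing.scale/=; ring.
Qed.

(** The derivative is left in the shape of the summands of [energy_identity]. *)
Lemma is_derive_energy_flux (R : realType) (H : 'rV[R]_3 -> 'rV[R]_3) (i : 'I_3)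
    (y : 'rV[R]_3) : C2 H ->
  is_derive y (delta_mx 0 i) (energy_flux H i)
    (7^-1 * (dot (H y) (H y) + y 0 i * (2 * dot (partial i H y) (H y))) +
     (cross (partial i (fun z => cross (curl H z) (H z)) y) (H y) +
      cross (cross (curl H y) (H y)) (partial i H y)) 0 i).
Proof.
move=> H2; have H1 := H2.1; have E1 := C1_cross (C1_curl H2) H1.
have dH k := partial_coord k ((H1 i).1 y).
have dE k := partial_coord k ((E1 i).1 y).
have dx := is_derive_cross dE dH i.
have dq k := is_deriveM (dH k) (dH k).
have d1 := is_deriveM (is_derive_coord i y (delta_mx 0 i))
  (is_deriveD (is_deriveD (dq 0) (dq 1)) (dq 2%:R)).
have d2 := is_deriveM (is_derive_cst (7^-1 : R) y (delta_mx 0 i)) d1.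
apply: (is_derive_eq (is_deriveD d2 dx)).
congr (_ + _); rewrite !dot3 mxE !eqxx/=.
rewrite !fctE /GRing.scale/=.
generalize (partial i H y) (H y) => p h.
ring.
Qed.

(* [a i] and [e i] stand for the i-th partial derivatives of [H] and of
   [E = J x H]; the identity is [div (E x H) = H . curl E - E . J] together with
   [E . J = 0]. *)
Lemma energy_identity (R : realType) (y h : 'rV[R]_3) (a e : 'I_3 -> 'rV[R]_3) :
  let curl3 (p : 'I_3 -> 'rV[R]_3) := vec3 (p 1 0 2%:R - p 2%:R 0 1)
    (p 2%:R 0 0 - p 0 0 2%:R) (p 0 0 1 - p 1 0 0) in
  (forall k, 3 / 7 * h 0 k + 2 / 7 * dot (\row_i a i 0 k) y + curl3 e 0 k = 0) ->
  \sum_i (7^-1 * (dot h h + y 0 i * (2 * dot (a i) h)) +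
     (cross (e i) h + cross (cross (curl3 a) h) (a i)) 0 i) = 0.
Proof.
move=> curl3 eq.
pose X k := 3 / 7 * h 0 k + 2 / 7 * dot (\row_i a i 0 k) y + curl3 e 0 k.
(* The divergence equals the scalar product of [h] with the left side [X] of the profile equation, a
   polynomial identity in all the entries. *)
transitivity (h 0 0 * X 0 + h 0 1 * X 1 + h 0 2%:R * X 2%:R); last first.
  by rewrite /X !eq !mulr0 !addr0.
rewrite /X sum_ord3 !dot3 /curl3 !vec3E !mxE/= ?mxE.
by field.
Qed.

Lemma divergence_energy_flux (R : realType) (H : 'rV[R]_3 -> 'rV[R]_3)
    (y : 'rV[R]_3) : C2 H ->
  (forall k, 3 / 7 * H y 0 k +
     2 / 7 * dot (\row_i derive (fun z => H z 0 k) y (delta_mx 0 i)) y +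
     hall H y 0 k = 0) ->
  \sum_i derive (energy_flux H i) y (delta_mx 0 i) = 0.
Proof.
move=> H2 eq; have H1 := H2.1.
under eq_bigr do rewrite (@derive_val _ _ _ _ _ _ _ (is_derive_energy_flux _ y H2)).
apply: (energy_identity (a := fun i => partial i H y)
  (e := fun i => partial i (fun z => cross (curl H z) (H z)) y)) => k.
rewrite -[RHS](eq k); congr (_ + _ * dot _ _ + _).
apply/rowP => i; rewrite !mxE.
by rewrite (@derive_val _ _ _ _ _ _ _ (partial_coord k ((H1 i).1 y))).
Qed.

(** * Outward flux through the faces of a large cube *)

Lemma cross_cross_le (R : realType) (J h : 'rV[R]_3) (i : 'I_3) :
  `|cross (cross J h) h 0 i| <= enorm J * enorm h ^+ 2.
Proof.
apply: le_trans (coord_le_enorm _ _) _; apply: le_trans (enorm_cross _ _) _.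
by rewrite expr2 mulrA ler_wpM2r ?enorm_ge0// enorm_cross.
Qed.

(** The radial part contributes r |H|^2 / 7 in the outward direction, and the bound on the curl lets
    the Hall part cancel at most half of it. *)
Lemma energy_flux_face (R : realType) (H : 'rV[R]_3 -> 'rV[R]_3) (i : 'I_3)
    (y : 'rV[R]_3) (r : R) :
  enorm (curl H y) <= r / 14 ->
  (y 0 i = r -> r / 14 * enorm (H y) ^+ 2 <= energy_flux H i y) /\
  (y 0 i = - r -> energy_flux H i y <= - (r / 14 * enorm (H y) ^+ 2)).
Proof.
move=> Jr; have := cross_cross_le (curl H y) (H y) i.
have S0 : 0 <= enorm (H y) ^+ 2 by exact: sqr_ge0.
have := ler_wpM2r S0 Jr.
rewrite /energy_flux -!expr2 -enorm_sqr ler_norml.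
move: (enorm (H y) ^+ 2) S0 => S S0 JS /andP[lo up].
by split=> ->; lra.
Qed.

(** On the boundary of the cube |y| lies between r and 2r. Hence |J| is at most C |y| / |y|^delta,
    so at most 2 C r / r^delta, which is below r / 14 for large r. *)
Lemma energy_flux_outward (R : realType) (H : 'rV[R]_3 -> 'rV[R]_3)
    (delta c C M p : R) :
  0 < delta -> 0 < c -> 0 < C -> 0 <= p ->
  (forall y, M <= enorm y -> c * enorm y `^ (- p) <= enorm (H y) /\
     enorm (curl H y) <= C * enorm y `^ (1 - delta)) ->
  exists r m, [/\ 0 < r, 0 < m &
    forall i (y : 'rV[R]_3), (forall j, `|y 0 j| <= r) ->
      (y 0 i = r -> m <= energy_flux H i y) /\
      (y 0 i = - r -> energy_flux H i y <= - m)].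
Proof.
move=> d0 c0 C0 p0 HM.
(* Chosen so that q^delta = 28 C, the threshold at which 2 C r / r^delta is at most r / 14. *)
pose q := (28 * C) `^ delta^-1.
have q0 : 0 < q by rewrite powR_gt0// mulr_gt0.
pose r := Num.max M q.
have r0 : 0 < r by rewrite lt_max q0 orbT.
have rd : 28 * C <= r `^ delta.
  rewrite -[leLHS](_ : q `^ delta = _); last first.
    by rewrite /q -powRrM mulVf ?gt_eqF// powRr1// mulr_ge0// ltW.
  by rewrite ge0_ler_powR ?nnegrE ?(ltW d0) ?(ltW q0) ?(ltW r0)// le_max lexx orbT.
(* Lower bound for |H| on the boundary: the power -p is nonincreasing and |y| is at most 2r. *)
pose m0 := c * (2 * r) `^ (- p).
have r20 : 0 < 2 * r by rewrite mulr_gt0.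
have m00 : 0 < m0 by rewrite mulr_gt0// powR_gt0.
exists r, (r / 14 * m0 ^+ 2); split => //.
  by rewrite mulr_gt0 ?divr_gt0// exprn_gt0.
move=> i y yr.
suff ri : `|y 0 i| = r ->
    enorm (curl H y) <= r / 14 /\ r / 14 * m0 ^+ 2 <= r / 14 * enorm (H y) ^+ 2.
  split=> yi.
    have [|J m] := ri; first by rewrite yi gtr0_norm.
    by apply: le_trans m _; exact: (energy_flux_face i J).1.
  have [|J m] := ri; first by rewrite yi normrN gtr0_norm.
  by apply: le_trans ((energy_flux_face i J).2 yi) _; rewrite lerN2.
move=> yi; have ry : r <= enorm y by rewrite -yi coord_le_enorm.
have yr2 : enorm y <= 2 * r by exact: enorm_le_coord.
have y0 : 0 < enorm y by exact: lt_le_trans ry.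
have [Hlow Jup] : c * enorm y `^ (- p) <= enorm (H y) /\
     enorm (curl H y) <= C * enorm y `^ (1 - delta).
  by apply: HM; apply: le_trans ry; rewrite le_max lexx.
split; last first.
  rewrite ler_wpM2l ?divr_ge0 ?(ltW r0)// ler_pXn2r ?nnegrE ?enorm_ge0 ?(ltW m00)//.
  apply: le_trans Hlow; rewrite ler_wpM2l ?(ltW c0)// !powRN.
  by rewrite lef_pV2 ?posrE ?powR_gt0// ge0_ler_powR ?nnegrE ?(ltW y0) ?(ltW r20).
apply: le_trans Jup _; rewrite powRB; last by rewrite (gt_eqF y0) implybT.
rewrite powRr1 ?(ltW y0)// mulrA ler_pdivrMr ?powR_gt0//.
(* Numerator and denominator of |y| / |y|^delta are bounded separately, so the sign of 1 - delta
   does not matter. *)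
apply: le_trans (_ : C * (2 * r) <= _); first by rewrite ler_wpM2l// ltW.
apply: le_trans (_ : r / 14 * r `^ delta <= _).
  rewrite (_ : C * (2 * r) = r / 14 * (28 * C)); last by field.
  by rewrite ler_wpM2l// divr_ge0// ltW.
rewrite ler_wpM2l ?divr_ge0 ?(ltW r0)//.
by rewrite ge0_ler_powR ?nnegrE ?(ltW d0) ?(ltW r0) ?(ltW y0).
Qed.

Theorem theorem1p3 (R : realType) (T alpha t0 rho0 : R) (x0 : 'rV[R]_3)
    (B : 'rV[R]_3 -> R -> 'rV[R]_3) (H : 'rV[R]_3 -> 'rV[R]_3)
    (delta c C : R)
    (hT : 0 < T) (halpha : alpha = 3 / 2) (ht0 : 0 < t0 < T)
    (hrho0 : 0 < rho0)
    (hB : classical_solution t0 T B)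
    (hBH : locally_self_similar alpha t0 T rho0 x0 B H)
    (hL2 : L2_field H) (hC2 : C2 H)
    (hdelta : 0 < delta) (hc : 0 < c) (hC : 0 < C)
    (hH : exists M : R, forall y : 'rV[R]_3, M <= enorm y ->
       c * enorm y `^ (- (3 / 2) - delta) <= enorm (H y) /\
       enorm (curl H y) <= C * enorm y `^ (1 - delta)) :
  forall y : 'rV[R]_3, H y = 0.
Proof.
have /andP[_ t0T] := ht0.
have divF y : \sum_i derive (energy_flux H i) y (delta_mx 0 i) = 0.
  apply: divergence_energy_flux => // k.
  have a2 : -2 < alpha by rewrite halpha; lra.
  have := profile_equation y k a2 t0T hrho0 hB hBH hC2.
  (* At alpha = 3/2 the coefficients are 3/7 and 2/7, exactly those produced by div (|H|^2 y / 7) in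
     dimension three. *)
  have -> : alpha / (alpha + 2) = 3 / 7 by rewrite halpha; field.
  by have -> : 1 / (alpha + 2) = 2 / 7 by rewrite halpha; field.
have [M HM] := hH.
have p0 : 0 <= 3 / 2 + delta by lra.
rewrite -opprD in HM.
have [r [m [r0 m0 flux]]] := energy_flux_outward hdelta hc hC p0 HM.
have C1F i := @C1_energy_flux _ _ i hC2.
(* The energy flux is divergence-free and yet leaves the cube through every face. *)
exfalso; apply: (divergence_free_no_outflow (F := energy_flux H) r0 m0) => //.
- by move=> i x; exact: (C1F i i).1.
- by move=> i; exact: (C1F i i).2.
- by move=> i x xr; exact: (flux i x xr).1.
- by move=> i x xr; exact: (flux i x xr).2.
Qed.
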